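(* Let $(A_i)_{i=1}^\infty$ be an infinite sequence of mutually independent events in a probability space with probability measure $\mathbb{P}$. Let $\omega \colon \mathbb{N}^+ \to \mathbb{N}^+$ be a function such that for all $N \in \mathbb{N}^+$ \[ \sum_{i=1}^{\omega(N)} \mathbb{P}[A_i] \geq N. \] Then, for all $n, N \in \mathbb{N}^+$, \[ \mathbb{P}\left[\bigcup_{i=n}^{\omega(n + N - 1)} A_i\right] \geq 1 - e^{-N}. \]
   Context: $\mathbb{N}^+$ denotes the positive integers. The hypothesis on $\omega$ is what is meant by saying that the sequence of partial sums $(\sum_{i=1}^n \mathbb{P}[A_i])_{n=1}^\infty$ diverges with rate $\omega$. *)

(* Defs.v *)
From HB Require Import structures.
From mathcomp Require Import all_boot all_order all_algebra finmap.
From mathcomp Require Import all_classical all_reals all_analysis.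

Set Implicit Arguments.
Unset Strict Implicit.
Unset Printing Implicit Defensive.

Import Order.TTheory GRing.Theory Num.Theory.

Local Open Scope classical_set_scope.
Local Open Scope ring_scope.

(* The family is indexed by the subset I of K: values of A outside I are
   unconstrained. For J empty the product rule reads P [set: T] = 1. *)
Definition mutually_independent (d : measure_display) (T : measurableType d)
    (R : realType) (P : probability T R) (K : choiceType) (I : set K)
    (A : K -> set T) : Prop :=
  (forall i, I i -> measurable (A i)) /\
  (forall J : {fset K}, [set` J] `<=` I ->
     P (\bigcap_(i in [set` J]) A i) = (\prod_(i <- J) P (A i))%E).

(* Main.v *)
(** By inclusion-exclusion on one event at a time, independence passes to
    complements, so the probability that no [A i] with [n <= i <= M] occurs is
    the product of the [1 - P (A i)], which is at most
    [expR (- \sum_(n <= i < M.+1) P (A i))]. For [M = omega (n + N - 1)] that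
    sum is at least [N], because the first [n - 1] terms of the full sum
    contribute at most [n - 1]. *)
Require Import Defs.
From HB Require Import structures.
From mathcomp Require Import all_boot all_order all_algebra finmap.
From mathcomp Require Import all_classical all_reals all_analysis.

Import Order.TTheory GRing.Theory Num.Theory.

Local Open Scope classical_set_scope.
Local Open Scope ring_scope.

(* Keeping track of a list [t] of events that do occur is what makes the
   induction on [s] go through. *)
Lemma mutually_independent_setD (d : measure_display) (T : measurableType d)
    (R : realType) (P : probability T R) (K : choiceType) (I : set K)
    (A : K -> set T) (s t : seq K) :
  mutually_independent P I A -> uniq (s ++ t) -> [set` s ++ t] `<=` I ->
  P (\bigcap_(i in [set` t]) A i `\` \bigcup_(i in [set` s]) A i) =
  ((\prod_(i <- t) fine (P (A i))) * \prod_(i <- s) (1 - fine (P (A i))))%:E.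
Proof.
move=> [mA indepA]; elim: s t => [|i s IHs] t.
  move=> /= Ut tI; rewrite set_nil bigcup_set0 setD0 big_nil mulr1 -prodEFin.
  (* Independence is stated over finite sets, so [t] passes through one; [uniq t] ensures that the
     product over it has the same factors. *)
  have mem_t : [set` [fset x in t]%fset] = [set` t].
    by apply/seteqP; split=> x /=; rewrite inE.
  have /indepA : [set` [fset x in t]%fset] `<=` I by rewrite mem_t.
  rewrite mem_t => ->.
  rewrite (perm_big t) /=; last first.
    by apply: uniq_perm => // x; rewrite inE.
  by apply: eq_big_seq => j jt; rewrite fineK// fin_num_measure//; exact/mA/tI.
rewrite /= mem_cat negb_or => /andP[/andP[is_ it] Ust] stI.
have Ii : I i by apply: stI; rewrite /= mem_head.
have stI' : [set` s ++ t] `<=` I.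
  by move=> j /= jst; apply: stI; rewrite /= inE jst orbT.
have mB : measurable (\bigcap_(j in [set` t]) A j `\` \bigcup_(j in [set` s]) A j).
  apply: measurableD.
    apply: fin_bigcap_measurable => // j /= jt.
    by apply/mA/stI'; rewrite /= mem_cat jt orbT.
  apply: fin_bigcup_measurable => // j /= js.
  by apply/mA/stI'; rewrite /= mem_cat js.
(* With [B] the event for [s] and [t], [P (B \ A i) = P B - P (B & A i)], and the last event is the
   one for [s] and [i :: t]. The induction hypothesis thus serves at both [t] and [i :: t]. *)
rewrite (bigcup_seq (i :: s)) big_cons -bigcup_seq setUC -setDDl.
rewrite measureD//; [|exact: mA|by rewrite -ge0_fin_numE// fin_num_measure].
have -> : (\bigcap_(j in [set` t]) A j `\` \bigcup_(j in [set` s]) A j) `&` A i =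
    \bigcap_(j in [set` i :: t]) A j `\` \bigcup_(j in [set` s]) A j.
  by rewrite setIC setIDA (bigcap_seq (i :: t)) big_cons -bigcap_seq.
rewrite /= !IHs//; last 2 first.
- by rewrite uniq_catC /= mem_cat negb_or is_ it uniq_catC.
- by move=> j /=; rewrite mem_cat inE orbCA -mem_cat => jst; apply: stI; rewrite /= inE.
rewrite !big_cons -EFinB; congr EFin.
by rewrite mulrBl mul1r mulrBr mulrCA !mulrA.
Qed.

Lemma mutually_independent_bigcup_ge (d : measure_display)
    (T : measurableType d) (R : realType) (P : probability T R)
    (K : choiceType) (I : set K) (A : K -> set T) (s : seq K) :
  mutually_independent P I A -> uniq s -> [set` s] `<=` I ->
  ((1 - expR (- \sum_(i <- s) fine (P (A i))))%:E <=
   P (\bigcup_(i in [set` s]) A i))%E.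
Proof.
move=> indepA Us sI; have [mA _] := indepA.
have mU : measurable (\bigcup_(i in [set` s]) A i).
  by apply: fin_bigcup_measurable => // i /sI; exact: mA.
(* For [t] empty the intersection is the whole space, which leaves the complement of the union. *)
have := @mutually_independent_setD _ _ _ _ _ _ _ s [::] indepA.
rewrite cats0 => /(_ Us sI).
rewrite set_nil bigcap_set0 setTD big_nil mul1r => PC.
rewrite -[X in P X]setCK probability_setC; last exact: measurableC.
rewrite PC lee_fin lerB//.
(* Factor by factor, [0 <= 1 - p <= expR (- p)]; the lower bound, needed to multiply the
   inequalities, is [p <= 1]. *)
rewrite -sumrN expR_sum; rewrite !big_seq; apply: ler_prod => i /sI/mA mAi.
rewrite expR_ge1Dx andbT subr_ge0 -lee_fin fineK ?fin_num_measure//.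
exact: probability_le1.
Qed.

Theorem theorem2p2 (d : measure_display) (T : measurableType d) (R : realType)
    (P : probability T R) (A : nat -> set T) (omega : nat -> nat)
    (A_indep : mutually_independent P [set i : nat | (0 < i)%N] A)
    (omega_gt0 : forall N : nat, (0 < N)%N -> (0 < omega N)%N)
    (omega_rate : forall N : nat, (0 < N)%N ->
       (N%:R%:E <= \sum_(1 <= i < (omega N).+1) P (A i))%E) :
  forall n N : nat, (0 < n)%N -> (0 < N)%N ->
    ((1 - expR (- N%:R))%:E <=
     P (\bigcup_(i in [set i : nat | (n <= i <= omega (n + N - 1))%N]) A i))%E.
Proof.
move=> n N n0 N0; have [mA _] := A_indep.
set M := omega (n + N - 1)%N.
have -> : [set i | (n <= i <= M)%N] = [set` index_iota n M.+1].
  by apply/seteqP; split=> i /=; rewrite mem_index_iota ltnS.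
have sI : [set` index_iota n M.+1] `<=` [set i : nat | (0 < i)%N].
  by move=> i /=; rewrite mem_index_iota => /andP[/(leq_trans n0)].
have := mutually_independent_bigcup_ge _ _ _ _ _ _ _ _
  A_indep (iota_uniq _ _) sI.
apply: le_trans.
rewrite lee_fin lerB// ler_expR lerN2.
have p_ge0 i : 0 <= fine (P (A i)) by exact: fine_ge0.
have p_le1 i : (0 < i)%N -> fine (P (A i)) <= 1.
  move=> i0; rewrite -lee_fin fineK ?fin_num_measure//; last exact: mA.
  by apply: probability_le1; exact: mA.
have nN0 : (0 < n + N - 1)%N by rewrite -addnBA// addn_gt0 n0.
have rate : (n + N - 1)%:R <= \sum_(1 <= i < M.+1) fine (P (A i)).
  have := omega_rate _ nN0; rewrite -lee_fin -sumEFin => /le_trans; apply.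
  rewrite !big_seq lee_sum// => i.
  rewrite mem_index_iota => /andP[i0 _].
  by rewrite fineK// fin_num_measure//; exact: mA.
have head : \sum_(1 <= i < n) fine (P (A i)) <= (n - 1)%:R.
  (* [n - 1] is read as a sum of ones, each bounding a probability. *)
  rewrite -[(n - 1)%N]muln1 -sum_nat_const_nat natr_sum !big_seq.
  by apply: ler_sum => i; rewrite mem_index_iota => /andP[/p_le1].
(* An inequality avoids proving that [M] reaches [n]: if [M.+1 < n], the tail is empty and the head
   only has extra nonnegative terms. *)
have split_le : \sum_(1 <= i < M.+1) fine (P (A i)) <=
    \sum_(1 <= i < n) fine (P (A i)) + \sum_(n <= i < M.+1) fine (P (A i)).
  have [nM|Mn] := leqP n M.+1; first by rewrite -big_cat_nat.
  rewrite (big_cat_nat (n := M.+1) _ (ltnW Mn))//= -addrA lerDl.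
  by rewrite addr_ge0// sumr_ge0.
(* As [0 < n], the truncated subtraction is exact and [(n - 1) + N] is the argument of [omega]. *)
rewrite -(lerD2l (n - 1)%:R) -natrD addnBAC//.
by apply: le_trans rate (le_trans split_le _); rewrite lerD2r.
Qed.
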